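(* Let $(\Omega_n,\mathcal{F}_n,p_n)$, $n\in\mathbb{N}$, be a sequence of probability spaces, let $g_n:\Omega_n\to\mathbb{R}$ be $\mathcal{F}_n$-measurable with $\mathbb{E}_{p_n}[e^{\beta g_n}]<\infty$ for all $\beta\in\mathbb{R}$, let $\beta_n>0$, and define the probability measure $q_n$ by $$\frac{dq_n}{dp_n}=\frac{e^{\beta_n g_n}}{\mathbb{E}_{p_n}[e^{\beta_n g_n}]}.$$ Let conditions C1--C5, the sequences $\sigma_n,\alpha_n,\tau_n$, the canonical test $\mathcal{T}^{\mathsf{can}}(T,\kappa)$ and its error probability $p_{\mathsf{error}}$ be as defined in the context. 1. If C1, C2, C3 and C4 hold, then $$\lim_{n\to\infty} d_{\mathsf{TV}}(p_n,q_n)=1\quad\text{if } \beta_n\sigma_n\to\infty .$$ Moreover, if it is known that $\beta_n\sigma_n\ge L_n$ for a known sequence $L_n\to\infty$ ($\beta_n$ itself being possibly unknown), then there is a choice $T_n\to\infty$, depending only on $L_n$ and $\tau_n$, such that the canonical test $\mathcal{T}^{\mathsf{can}}(T_n,g_n)$ distinguishes $H_0: X\sim p_n$ from $H_1: X\sim q_n$ with high probability from a single sample $X$, i.e. $p_{\mathsf{error}}\to 0$; the probabilities of type 1 and type 2 error are bounded above by a function of $\alpha_n$, $T_n$ and $L_n$ tending to $0$. 2. If C5 holds, then $$\lim_{n\to\infty} d_{\mathsf{TV}}(p_n,q_n)=0\quad\text{if }\beta_n\sigma_n\to 0 .$$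
   Context: $d_{\mathsf{TV}}$ is total variation distance. $d_{\mathsf{KS}}(\mu,\nu)=\sup_{x_0\in\mathbb{R}}|\mu((-\infty,x_0])-\nu((-\infty,x_0])|$ for probability measures $\mu,\nu$ on $\mathbb{R}$. $\mathcal{L}(X)$ is the law of $X$. $\mathcal{N}(0,1)$ is the standard normal law. Conditions: C1. For some finite index set $M_n$, $\Omega_n=\bigcup_{m\in M_n}A_m$ is a partition into disjoint (measurable) sets $A_m$ with $p_n(A_m)>0$ for all $m\in M_n$. C2. For a set $S_n\subset M_n$, $p_n(\bigcup_{m\in S_n}A_m)\ge 1-\alpha_n$ for some sequence $\alpha_n\to0$. C3. Let $p^{(m)}$ be the probability measure on $A_m$ given by $p^{(m)}(A)=p_n(A)/p_n(A_m)$ for $A\subset A_m$, $A\in\mathcal{F}_n$, and let $X_m\sim p^{(m)}$. Let $e_m(g_n)=\mathbb{E}[g_n(X_m)]$ and $\sigma_m^2(g_n)=\mathrm{var}[g_n(X_m)]$ (write $\sigma_m=\sigma_m(g_n)$). For all $m,m'\in S_n$, $0<c\le \sigma_m^2(g_n)/\sigma_{m'}^2(g_n)\le C$ for some constants $c,C$ independent of $n$. Then $\sigma_n$ denotes any sequence such that $c\,\sigma_m(g_n)\le\sigma_n\le C\,\sigma_m(g_n)$ for some absolute constants $c,C>0$ and every $m\in S_n$. The function $g_n$ may have $\beta_n$ as a parameter, but $g_n(x)-e_m(g_n)$ does not depend on $\beta_n$ for $x\in A_m$. C4. There is a sequence $\tau_n\to0$ such that $\sup_{m\in S_n}d_{\mathsf{KS}}\big(\mathcal{L}\big(\tfrac{g_n(X_m)-e_m(g_n)}{\sigma_m}\big),\mathcal{N}(0,1)\big)<\tau_n$.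 C5. Condition C3 holds (with respect to a partition and a set $S_n$ as in C1, C2), and, for $X\sim p_n$, $\mathrm{var}(g_n(X))=O(\sigma_n^2)$ and $$\log\mathbb{E}\big[e^{\beta(g_n(X)-\mathbb{E}g_n(X))}\big]\le\frac{C\beta^2\sigma_n^2}{1-|\beta|D\sigma_n}\quad\text{for all }|\beta|<\frac{1}{D\sigma_n},$$ for absolute constants $C,D$ independent of $n$. Canonical test. Let $m(x)=m_0$ iff $x\in A_{m_0}$. For $T\ge0$ and real-valued $\kappa$ on $\Omega_n$, put $e_m(\kappa)=\mathbb{E}[\kappa(X_m)]$, $\sigma_m^2(\kappa)=\mathrm{var}[\kappa(X_m)]$. The canonical test $\mathcal{T}^{\mathsf{can}}(T,\kappa)$ has decision function $\mathcal{D}^{\mathsf{can}}$: if $m(X)\notin S_n$, then $\mathcal{D}^{\mathsf{can}}(X)=H_1$; if $m(X)\in S_n$ and $\frac{\kappa(X)-e_{m(X)}(\kappa)}{\sigma_{m(X)}(\kappa)}\ge T$, then $\mathcal{D}^{\mathsf{can}}(X)=H_1$; otherwise $\mathcal{D}^{\mathsf{can}}(X)=H_0$. For a test with decision function $\mathcal{D}$, $p_{\mathsf{error}}=\max\big(\mathbb{P}[\mathcal{D}(X)=H_0\mid X\sim q_n],\ \mathbb{P}[\mathcal{D}(X)=H_1\mid X\sim p_n]\big)$. Type 1 error: deciding $H_1$ under $H_0$; type 2 error: deciding $H_0$ under $H_1$. *)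

(* Defs.v *)
From HB Require Import structures.
From mathcomp Require Import all_boot all_order all_algebra.
From mathcomp Require Import all_classical all_reals all_analysis.
From mathcomp Require Import measurable_realfun.

Set Implicit Arguments.
Unset Strict Implicit.
Unset Printing Implicit Defensive.

Import Order.TTheory GRing.Theory Num.Theory.
Import numFieldNormedType.Exports.

Local Open Scope classical_set_scope.
Local Open Scope ring_scope.

(* Normalized so as to take values in [0, 1]. *)
Definition dTV d (T : measurableType d) (R : realType)
    (mu nu : probability T R) : \bar R :=
  ereal_sup [set `|mu B - nu B|%E | B in @measurable d T].

(* Stated on set functions, because the laws given by [distribution] and
   [normal_prob] live on two structures on R (same sets, different displays). *)
Definition dKS (R : realType) (mu nu : set R -> \bar R) : \bar R :=
  ereal_sup (range (fun x : R => `|mu [set` `]-oo, x]] - nu [set` `]-oo, x]]|%E)).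

Section standardize.
Context d (T : measurableType d) (R : realType).
Implicit Types (P : probability T R) (X : T -> R).

Definition mean P X : R := fine 'E_P[X].

Definition stddev P X : R := Num.sqrt (fine 'V_P[X]).

Definition standardize P X (x : T) : R := (X x - mean P X) / stddev P X.

Lemma measurable_standardize P (X : {mfun T >-> R}) :
  measurable_fun [set: T] (standardize P X).
Proof.
by apply: measurable_funM => //; exact: measurable_funB.
Qed.

HB.instance Definition _ P (X : {mfun T >-> R}) :=
  isMeasurableFun.Build _ _ _ _ (standardize P X) (measurable_standardize P X).

End standardize.

(* [gpar n b] is the function g_n for the parameter value [b]: g_n may have
   beta_n as a parameter, and g_n itself is [gpar n (beta n)].  A g_n that does
   not involve beta_n is the case where [gpar n] is constant. *)
Record model (R : realType) := Model {
  disp : nat -> measure_display;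
  Omega : forall n, measurableType (disp n);
  pn : forall n, probability (Omega n) R;
  qn : forall n, probability (Omega n) R;
  beta : nat -> R;
  beta_gt0 : forall n, 0 < beta n;
  gpar : forall n, R -> {mfun Omega n >-> R};
  g_mmt : forall n (t : R), ('M_(pn n) (gpar n (beta n)) t < +oo)%E;
  q_density : forall n (B : set (Omega n)), measurable B ->
    qn n B = (\int[pn n]_(x in B)
      (expR (beta n * gpar n (beta n) x) /
       fine ('M_(pn n) (gpar n (beta n)) (beta n)))%:E)%E }.

Definition gn (R : realType) (E : model R) (n : nat) : {mfun Omega E n >-> R} :=
  gpar E n (beta E n).

Record blocks (R : realType) (E : model R) := Blocks {
  Mn : nat -> finType;
  An : forall n, Mn n -> set (Omega E n);
  measurable_An : forall n (m : Mn n), measurable (An m);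
  Sn : forall n, {set Mn n} }.

Inductive hypothesis := H0 | H1.

Section conditions.
Context (R : realType) (E : model R) (B : blocks E).
Implicit Types (n : nat) (alpha tau sigma : nat -> R) (c C D : R).

(* The measure p^(m), seen as a probability on the whole of Omega_n that is
   concentrated on A_m: U |-> p_n (U `&` A_m) / p_n A_m.  The second argument
   of [mnormalize] is only used if p_n A_m = 0, which C1 excludes. *)
Definition pcond n (m : Mn B n) : probability (Omega E n) R :=
  mnormalize (mrestr (pn E n) (measurable_An m)) (pn E n).

Definition C1 : Prop := forall n,
  [/\ \bigcup_(m in [set: Mn B n]) An m = [set: Omega E n],
      trivIset [set: Mn B n] (@An R E B n)
    & forall m : Mn B n, (0 < pn E n (An m))%E].

Definition C2 alpha : Prop :=
  alpha n @[n --> \oo] --> (0 : R) /\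
  forall n, ((1 - alpha n)%:E <= pn E n (\bigcup_(m in [set` Sn B n]) An m))%E.

Definition C3 c C : Prop :=
  [/\ 0 < c,
      forall n (m m' : Mn B n), m \in Sn B n -> m' \in Sn B n ->
        c <= fine 'V_(pcond m)[gn E n] / fine 'V_(pcond m')[gn E n] <= C
    & forall n (m : Mn B n) (b b' : R) (x : Omega E n),
        0 < b -> 0 < b' -> An m x ->
        gpar E n b x - mean (pcond m) (gpar E n b) =
        gpar E n b' x - mean (pcond m) (gpar E n b')].

Definition C3_scale c C sigma : Prop :=
  [/\ 0 < c, 0 < C
    & forall n (m : Mn B n), m \in Sn B n ->
        c * stddev (pcond m) (gn E n) <= sigma n
        <= C * stddev (pcond m) (gn E n)].

Definition C4 tau : Prop :=
  tau n @[n --> \oo] --> (0 : R) /\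
  forall n,
    (ereal_sup [set dKS (distribution (pcond m)
                                      (standardize (pcond m) (gn E n)))
                        (normal_prob 0 1) | m in [set` Sn B n]]
     < (tau n)%:E)%E.

(* The part of C5 that comes in addition to C3. *)
Definition C5 C D sigma : Prop :=
  [/\ 0 < C, 0 < D,
      (fun n => fine 'V_(pn E n)[gn E n] : R^o) =O_\oo
        (fun n => sigma n ^+ 2 : R^o)
    & forall n (b : R), `|b| < (D * sigma n)^-1 ->
        ln (fine 'E_(pn E n)[fun x =>
                    expR (b * (gn E n x - mean (pn E n) (gn E n)))])
        <= C * b ^+ 2 * sigma n ^+ 2 / (1 - `|b| * D * sigma n)].

(* Under C1, [block x] is [Some m] for the unique m such that x is in A_m. *)
Definition block n (x : Omega E n) : option (Mn B n) :=
  [pick m : Mn B n | x \in An m].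

Definition can_test n (T : R) (kappa : Omega E n -> R) (x : Omega E n) :
    hypothesis :=
  if block x is Some m then
    if m \notin Sn B n then H1
    else if T <= standardize (pcond m) kappa x then H1 else H0
  else H1.

Definition type1_error n (Dec : Omega E n -> hypothesis) : \bar R :=
  pn E n [set x | Dec x = H1].

Definition type2_error n (Dec : Omega E n -> hypothesis) : \bar R :=
  qn E n [set x | Dec x = H0].

Definition p_error n (Dec : Omega E n -> hypothesis) : \bar R :=
  Order.max (type2_error Dec) (type1_error Dec).

End conditions.

(* Main.v *)
Require Import Defs.
From HB Require Import structures.
From mathcomp Require Import all_boot all_order all_algebra.
From mathcomp Require Import all_classical all_reals all_analysis.
From mathcomp Require Import measurable_realfun ring lra.

Import Order.TTheory GRing.Theory Num.Theory.
Import numFieldNormedType.Exports.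

Local Open Scope classical_set_scope.
Local Open Scope ring_scope.

(** Part 1. On a block A_m the density dq/dp is a constant times
    exp (beta sigma_m Y), where Y is the standardized statistic that the
    canonical test compares with T.  Hence, with b = beta sigma_m, the part of
    A_m where Y < T carries at most the constant times exp (b T), while the part
    where Y > T + 1 carries at least the constant times
    exp (b (T + 1)) p(Y > T + 1 | A_m): the q-probability of Y < T given A_m is
    at most exp (- b) / p(Y > T + 1 | A_m) ([tilt_lower_tail]).  By C4 the
    denominator is at least G (T + 1) - tau, with G the standard normal tail,
    so the type 2 error is small as soon as G (T + 1) is at least 2 tau and
    not smaller than 1 / L, for b is at least L / C' ([type2_error_le]).  The
    same condition absorbs tau in the bound on the type 1 error, which is then
    at most alpha + 2 G (T - 1) ([type1_error_le]).  The threshold is the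
    largest integer below L for which G (T + 1) satisfies both constraints; it
    tends to infinity because G is positive everywhere ([threshold_cvgy]).  The
    limit of the total variation distance is the case L = beta sigma: the
    acceptance region has p-probability tending to 1 and q-probability tending to 0.

    Part 2. The total variation distance is controlled by the chi-square
    distance E_p[(dq/dp)^2] - 1 ([tilt_dTV_le]).  For the tilted law,
    E_p[(dq/dp)^2] = M (2 beta) / M (beta)^2, with M the moment generating
    function of g.  Jensen bounds M (beta) below by exp (beta E g)
    ([mgf_ge]), so that the ratio is at most the centered moment generating
    function at 2 beta, which C5 makes tend to 1 when beta sigma tends to 0
    ([chi2_density_le]). *)

(** * The standard normal tail and the threshold of the test *)

Section gaussian_tail.
Context {R : realType}.

Definition gauss_tail (x : R) : R := fine (@normal_prob R 0 1 `]x, +oo[).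

Lemma gauss_tailE x : @normal_prob R 0 1 `]x, +oo[ = (gauss_tail x)%:E.
Proof. by rewrite /gauss_tail fineK// fin_num_measure. Qed.

Lemma gauss_cdfE x : @normal_prob R 0 1 [set` `]-oo, x]] = (1 - gauss_tail x)%:E.
Proof.
rewrite -setCitvr probability_setC//.
by rewrite [X in (1 - X)%E]gauss_tailE.
Qed.

Lemma gauss_tail_nincr : {homo gauss_tail : x y / x <= y >-> y <= x}.
Proof.
move=> x y xy; rewrite -lee_fin -!gauss_tailE.
by rewrite le_measure ?inE//; exact: subitvPl.
Qed.

Lemma gauss_tail_gt0 x : 0 < gauss_tail x.
Proof.
(* The density is at least [c] where the absolute value is at most `|x| + 1. *)
pose c : R := normal_peak 1 * expR (- (`|x| + 1) ^+ 2 / 2).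
have c0 : 0 < c by rewrite mulr_gt0 ?expR_gt0 ?normal_peak_gt0.
rewrite (lt_le_trans c0)// -lee_fin -gauss_tailE.
have xx : (@normal_prob R 0 1 `]x, (x + 1)%R] <= @normal_prob R 0 1 `]x, +oo[)%E.
  by rewrite le_measure ?inE//; apply: subset_itvl.
apply: le_trans xx.
have -> : c%:E = (\int[lebesgue_measure]_(y in `]x, (x + 1)%R]) (cst c%:E) y)%E.
  rewrite integral_cst//= lebesgue_measure_itv/= lte_fin ltrDl ltr01.
  by rewrite -EFinD -EFinM; congr EFin; ring.
apply: ge0_le_integral => //.
- by move=> y _; rewrite lee_fin ltW.
- by apply/measurable_EFinP; apply: measurable_funTS; exact: measurable_normal_pdf.
- move=> y/=; rewrite in_itv/= => /andP[xy yx].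
  rewrite lee_fin normal_pdfE ?oner_eq0// ler_wpM2l ?normal_peak_ge0//.
  rewrite /normal_fun ler_expR subr0 expr1n !mulNr lerN2 ler_pM2r ?invr_gt0 ?ltr0n//.
  have := ler_norm x; have := ler_norm (- x); rewrite normrN => h1 h2.
  have : 0 <= (`|x| + 1 - y) * (`|x| + 1 + y) by apply: mulr_ge0; lra.
  by rewrite !expr2; lra.
Qed.

Lemma gauss_tail_lt (e : R) : 0 < e -> exists k : nat, gauss_tail k%:R < e.
Proof.
move=> e0; pose F (k : nat) : set R := `]k%:R, +oo[%classic.
have F0 : \bigcap_k F k = set0.
  rewrite -subset0 => t /(_ (Num.truncn t).+1 I).
  by rewrite /F/= in_itv/= andbT ltNge ltW// truncnS_gt.
have : @normal_prob R 0 1 (F k) @[k --> \oo] --> @normal_prob R 0 1 (\bigcap_k F k).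
  apply: nonincreasing_cvg_mu => [|k||m n mn].
  - by rewrite [X in (X < _)%E]gauss_tailE ltry.
  - by rewrite /F.
  - by apply: bigcap_measurable => // k _; rewrite /F.
  - apply/subsetPset => x; rewrite /F/= !in_itv/= !andbT; apply: le_lt_trans.
    by rewrite ler_nat.
rewrite F0 measure0.
have -> : (fun k => @normal_prob R 0 1 (F k)) = EFin \o (fun k => gauss_tail k%:R).
  by apply/funext => k; rewrite /F gauss_tailE.
move=> /fine_cvgP[_ /=] /cvgr_lt /(_ _ e0)[k _ /(_ k (leqnn k))/= ke].
by exists k.
Qed.

Lemma gauss_tail_cvg0 (u : nat -> R) :
  u n @[n --> \oo] --> +oo -> gauss_tail (u n) @[n --> \oo] --> 0.
Proof.
move=> uoo; apply/cvgr0Pnorm_lt => e e0.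
have [k ke] := gauss_tail_lt _ e0.
near=> n; rewrite ger0_norm ?ltW ?gauss_tail_gt0//.
apply: le_lt_trans ke; apply: gauss_tail_nincr; near: n.
by move/cvgryPge: uoo; apply.
Unshelve. all: by end_near. Qed.

End gaussian_tail.

Section threshold.
Context {R : realType}.

(** The largest k such that both constraints hold at k + 1, and 0 if there is
    none.  Searching below [truncn l] makes this the maximum of a finite set and
    gives 0 when l < 1; the constraint [l^-1 <= gauss_tail _] ensures that the
    factor [exp (- l / C)] beats the inverse of the tail, whatever the constant
    C is, so that the threshold need not depend on C. *)
Definition threshold (l t : R) : R :=
  (\max_(k < Num.truncn l |
     (2 * t <= gauss_tail k.+1%:R) && (l^-1 <= gauss_tail k.+1%:R)) k)%:R.

Lemma thresholdP l t : threshold l t = 0 \/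
  [/\ 1 <= threshold l t, 2 * t <= gauss_tail (threshold l t + 1)
    & l^-1 <= gauss_tail (threshold l t + 1)].
Proof.
rewrite /threshold; set m := (\max_(_ < _ | _) _)%N.
pose good (k : nat) := k = 0%N \/
  2 * t <= gauss_tail k.+1%:R /\ l^-1 <= gauss_tail k.+1%:R.
suff : good m.
  case: (posnP m) => [->|m0]; first by left.
  by case=> [->|[h1 h2]]; [left|right; rewrite natr1 ler1n].
apply: (big_ind good).
- by left.
- by move=> x y hx hy; rewrite /maxn; case: ifP.
- by move=> i /andP[h1 h2]; right.
Qed.

(** Any fixed K is eventually admissible, since [gauss_tail K.+1] is positive
    while the two lower bounds imposed on it tend to 0. *)
Lemma threshold_cvgy (L tau : nat -> R) :
  L n @[n --> \oo] --> +oo -> tau n @[n --> \oo] --> 0 ->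
  threshold (L n) (tau n) @[n --> \oo] --> +oo.
Proof.
move=> Loo tau0; apply/cvgryPge => A.
set K := (Num.truncn A).+1.
have G0 := gauss_tail_gt0 (K.+1%:R : R).
near=> n.
have L0 : 0 < L n by near: n; move/cvgryPgt: Loo; apply.
have KL : (K < Num.truncn (L n))%N.
  rewrite truncn_gt_nat.
  by near: n; move/cvgryPge: Loo; apply.
apply: (@le_trans _ _ K%:R); first by rewrite ltW// truncnS_gt.
rewrite ler_nat -[K]/(nat_of_ord (Ordinal KL)).
apply: leq_bigmax_cond; apply/andP; split => /=.
  have : tau n <= gauss_tail K.+1%:R / 2; last by lra.
  by near: n; apply: (cvgr_le _ tau0); lra.
rewrite -[leRHS]invrK lef_pV2 ?posrE ?invr_gt0//.
by near: n; move/cvgryPge: Loo; apply.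
Unshelve. all: by end_near. Qed.

End threshold.

(** * Exponential tilting and total variation *)

Section mfun_level_sets.
Context {d} {T : measurableType d} {R : realType} (f : {mfun T >-> R}) (a : R).

Lemma measurable_mfun_lt : measurable [set x | f x < a].
Proof.
rewrite (_ : mkset _ = f @^-1` `]-oo, a[%classic); first exact: measurable_funPTI.
by apply/seteqP; split => x /=; rewrite in_itv.
Qed.

Lemma measurable_mfun_gt : measurable [set x | a < f x].
Proof.
rewrite (_ : mkset _ = f @^-1` `]a, +oo[%classic); first exact: measurable_funPTI.
by apply/seteqP; split => x /=; rewrite in_itv/= andbT.
Qed.

End mfun_level_sets.

Section tilting.
Context {d} {T : measurableType d} {R : realType} (P Q : probability T R).
Context (f : {mfun T >-> R}).
Context (QE : forall U, measurable U -> Q U = (\int[P]_(x in U) (expR (f x))%:E)%E).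
Local Open Scope ereal_scope.

Let mexpf U : measurable_fun U (fun x => (expR (f x))%:E).
Proof.
by apply/measurable_EFinP; apply/measurableT_comp => //; exact: measurable_funTS.
Qed.

Lemma tilt_le U a : measurable U -> (forall x, U x -> f x <= a)%R ->
  Q U <= (expR a)%:E * P U.
Proof.
move=> mU Ua; rewrite QE// -integral_cst//.
apply: ge0_le_integral => //.
by move=> x Ux; rewrite lee_fin ler_expR Ua.
Qed.

Lemma tilt_ge U a : measurable U -> (forall x, U x -> a <= f x)%R ->
  (expR a)%:E * P U <= Q U.
Proof.
move=> mU Ua; rewrite QE// -integral_cst//.
apply: ge0_le_integral => //; first by move=> x _; rewrite lee_fin expR_ge0.
by move=> x Ux; rewrite lee_fin ler_expR Ua.
Qed.

(** Raising the log-density by s multiplies the density by exp s, so the upper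
    level set, which occupies a fraction at least c of A under P, outweighs the
    lower one under Q. *)
Lemma tilt_lower_tail A (a s c : R) : measurable A -> (0 < c)%R ->
  c%:E * P A <= P (A `&` [set x | a + s < f x]%R) ->
  Q (A `&` [set x | f x < a]%R) <= (expR (- s) / c)%:E * Q A.
Proof.
move=> mA c0 cP.
have mlo : measurable (A `&` [set x | f x < a]%R).
  by apply: measurableI => //; exact: measurable_mfun_lt.
have mhi : measurable (A `&` [set x | a + s < f x]%R).
  by apply: measurableI => //; exact: measurable_mfun_gt.
apply: (@le_trans _ _ ((expR a)%:E * P A)).
  have /(tilt_le _ _ mlo)/le_trans :
      (forall x, (A `&` [set x | f x < a]) x -> f x <= a)%R.
    by move=> x [_ /ltW].
  apply.
  by rewrite lee_pmul2l ?lte_fin ?expR_gt0// le_measure ?inE//; exact: subIsetl.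
have lo : (expR (a + s))%:E * (c%:E * P A) <= Q A.
  apply: le_trans (lee_wpmul2l _ cP) _; first by rewrite lee_fin expR_ge0.
  have /(tilt_ge _ _ mhi)/le_trans :
      (forall x, (A `&` [set x | a + s < f x]) x -> a + s <= f x)%R.
    by move=> x [_ /ltW].
  apply.
  by rewrite le_measure ?inE//; exact: subIsetl.
have -> : (expR a)%:E * P A =
    (expR (- s) / c)%:E * ((expR (a + s))%:E * (c%:E * P A)).
  rewrite !muleA -!EFinM expRD expRN; congr (_%:E * _).
  by field; rewrite !gt_eqF ?expR_gt0.
by rewrite lee_wpmul2l// lee_fin divr_ge0 ?expR_ge0 ?ltW.
Qed.

Let mexp2f U : measurable_fun U (fun x => (expR (2 * f x))%:E).
Proof.
apply/measurable_EFinP/measurableT_comp => //; apply: measurable_funM => //.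
exact: measurable_funTS.
Qed.

(** The integral over U of 2 c r <= r ^ 2 + c ^ 2, with r the density of Q with
    respect to P. *)
Lemma tilt_young U (c : R) : measurable U -> (0 <= c)%R ->
  (2 * c)%:E * Q U <= \int[P]_(x in U) (expR (2 * f x))%:E + (c ^+ 2)%:E * P U.
Proof.
move=> mU c0; rewrite QE// -integral_cst// -ge0_integralZl//; last first.
  by rewrite lee_fin; lra.
rewrite -ge0_integralD//; last by move=> x _; rewrite lee_fin sqr_ge0.
apply: ge0_le_integral => //.
- by move=> x _; rewrite -EFinM lee_fin mulr_ge0 ?expR_ge0//; lra.
- by apply: measurable_funeM.
- by apply: emeasurable_funD.
- move=> x _; rewrite -EFinM -EFinD lee_fin.
  have -> : expR (2 * f x) = (expR (f x) ^+ 2)%R by rewrite expRM_natl.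
  by have := sqr_ge0 (expR (f x) - c); rewrite !expr2; lra.
Qed.

(** A bound of the total variation distance by the chi-square distance, in which
    Cauchy-Schwarz is replaced by the inequality of arithmetic and geometric
    means with a free parameter e. *)
Lemma tilt_sub_le U (e del : R) : measurable U -> (0 < e)%R ->
  \int[P]_x (expR (2 * f x))%:E <= (1 + del)%:E ->
  Q U - P U <= ((e + del / e) / 2)%:E.
Proof.
move=> mU e0 chi2.
have mU' := measurableC mU.
have e1 : (0 <= 1 + e)%R by lra.
(* The tangent points 1 + e on U and 1 on its complement leave
   2 e (Q U - P U) <= del + e ^ 2 P U once the common terms cancel. *)
have := leeD (tilt_young _ _ mU e1) (tilt_young _ _ mU' ler01).
rewrite addeACA -ge0_integral_setU//; last by apply/disj_setPCl.
rewrite setUCr => /le_trans/(_ (leeD chi2 (lexx _))).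
rewrite !probability_setC//.
rewrite -(fineK (fin_num_measure Q _ mU)) -(fineK (fin_num_measure P _ mU)).
set q := fine _; set p := fine _.
rewrite -!EFinB -!EFinM -!EFinD !lee_fin => h.
have p1 : (p <= 1)%R.
  by rewrite -lee_fin /p fineK ?fin_num_measure// probability_le1.
rewrite -(ler_pM2l e0).
rewrite !expr2 in h.
have -> : (e * ((e + del / e) / 2) = (e * e + del) / 2)%R by field; rewrite gt_eqF.
have : (e * e * p <= e * e * 1)%R by rewrite ler_wpM2l// mulr_ge0// ltW.
nra.
Qed.

Lemma tilt_dTV_le (e del : R) : (0 < e)%R ->
  \int[P]_x (expR (2 * f x))%:E <= (1 + del)%:E ->
  dTV P Q <= ((e + del / e) / 2)%:E.
Proof.
move=> e0 chi2; apply: ge_ereal_sup => _ [U mU <-].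
have := tilt_sub_le _ _ _ (measurableC mU) e0 chi2.
have := tilt_sub_le _ _ _ mU e0 chi2.
rewrite !probability_setC//.
rewrite -(fineK (fin_num_measure Q _ mU)) -(fineK (fin_num_measure P _ mU)).
rewrite -!EFinN -!EFinD !lee_fin => h1 h2.
by rewrite ler_norml; apply/andP; split; lra.
Qed.

End tilting.

Section dTV_bounds.
Context {d} {T : measurableType d} {R : realType} (P Q : probability T R).
Local Open Scope ereal_scope.

Lemma dTV_ge U : measurable U -> P U - Q U <= dTV P Q.
Proof.
move=> mU; apply: le_trans (lee_abs _) _; apply: ereal_sup_ubound.
by exists U.
Qed.

Lemma dTV_ge0 : 0 <= dTV P Q.
Proof. by apply: le_trans (dTV_ge _ measurable0); rewrite !measure0 subee. Qed.

Lemma dTV_le1 : dTV P Q <= 1.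
Proof.
apply: ge_ereal_sup => _ [U mU <-].
have p01 : 0 <= P U <= 1 by rewrite measure_ge0 probability_le1.
have q01 : 0 <= Q U <= 1 by rewrite measure_ge0 probability_le1.
move: p01 q01.
rewrite -(fineK (fin_num_measure Q _ mU)) -(fineK (fin_num_measure P _ mU)).
rewrite -EFinB !lee_fin => /andP[p0 p1] /andP[q0 q1].
by rewrite ler_norml; apply/andP; split; lra.
Qed.

End dTV_bounds.


(** * The tilted law of the model *)

Section tilted_model.
Context {R : realType} (E : model R) (n : nat).
Local Notation P := (pn E n).
Local Notation Q := (qn E n).
Local Notation g := (gn E n).
Local Notation b := (beta E n).

Definition mgf (t : R) : R := fine ('M_P g t)%E.

Lemma mgfE t : (\int[P]_x (expR (t * g x))%:E = (mgf t)%:E)%E.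
Proof.
have -> : (\int[P]_x (expR (t * g x))%:E = 'M_P g t)%E.
  rewrite /mmt_gen_fun unlock; apply: eq_integral => x _ /=.
  by rewrite mulrC.
rewrite /mgf fineK// ge0_fin_numE; first exact: g_mmt.
by apply: expectation_ge0 => x; rewrite expR_ge0.
Qed.

(** If the normalizing constant were 0, its inverse would be 0 as well and the
    total mass of q_n would be 0. *)
Lemma mgf_beta_gt0 : 0 < mgf b.
Proof.
rewrite lt_def; apply/andP; split; last first.
  by apply/fine_ge0/expectation_ge0 => x; rewrite expR_ge0.
apply/eqP => Z0; have := @probability_setT _ _ _ Q.
rewrite q_density// [fine _]Z0 invr0.
rewrite integral0_eq => [/eqP|x _]; last by rewrite mulr0.
by rewrite eq_sym onee_eq0.
Qed.

Definition log_density (x : Omega E n) : R := b * g x - ln (mgf b).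

Let mlog_density : measurable_fun [set: Omega E n] log_density.
Proof. by apply: measurable_funB => //; apply: measurable_funM. Qed.

HB.instance Definition _ :=
  isMeasurableFun.Build _ _ _ _ log_density mlog_density.

Lemma qnE U : measurable U -> (Q U = \int[P]_(x in U) (expR (log_density x))%:E)%E.
Proof.
move=> mU; rewrite q_density//; apply: eq_integral => x _.
by rewrite /log_density expRD expRN lnK// posrE mgf_beta_gt0.
Qed.

Lemma integral_sqr_density :
  (\int[P]_x (expR (2 * log_density x))%:E = (mgf (2 * b) / mgf b ^+ 2)%:E)%E.
Proof.
have Z0 := mgf_beta_gt0.
transitivity (\int[P]_x (((mgf b ^+ 2)^-1)%:E * (expR (2 * b * g x))%:E))%E.
  apply: eq_integral => x _; rewrite -EFinM; congr EFin.
  rewrite /log_density mulrBr expRD expRN mulrA mulrC; congr (_^-1 * _).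
  by rewrite expRM_natl lnK// posrE.
rewrite ge0_integralZl//; last 2 first.
- by apply/measurable_EFinP; apply: measurableT_comp => //; exact: measurable_funM.
- by rewrite lee_fin invr_ge0 sqr_ge0.
by rewrite mgfE -EFinM mulrC.
Qed.

Lemma integrable_gn : P.-integrable [set: Omega E n] (EFin \o g).
Proof.
have mexp (t : R) : measurable_fun [set: Omega E n] (fun x => (expR (t * g x))%:E).
  by apply/measurable_EFinP; apply: measurableT_comp => //; exact: measurable_funM.
apply: (@le_integrable _ _ _ P _ measurableT _
  (fun x => (expR (1 * g x))%:E + (expR (-1 * g x))%:E)%E).
- exact/measurable_EFinP.
- move=> x _; rewrite -EFinD lee_fin mul1r mulN1r.
  rewrite [leRHS]ger0_norm ?addr_ge0 ?expR_ge0//.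
  have h1 := expR_ge1Dx (g x); have h2 := expR_ge1Dx (- g x).
  have := expR_ge0 (g x); have := expR_ge0 (- g x) => h3 h4.
  by rewrite ler_norml; apply/andP; split; lra.
- apply: integrableD => //; apply/integrableP; split => //.
  + under eq_integral do rewrite /= ger0_norm ?expR_ge0//.
    by rewrite mgfE ltry.
  + under eq_integral do rewrite /= ger0_norm ?expR_ge0//.
    by rewrite mgfE ltry.
Qed.

(** Jensen's inequality, obtained by integrating the tangent of
    [x |-> expR (t * x)] at the mean. *)
Lemma mgf_ge t : expR (t * mean P g) <= mgf t.
Proof.
set mu := mean P g; have ig := integrable_gn.
pose c := t * expR (t * mu); pose a := expR (t * mu) * (1 - t * mu).
have Eg : (\int[P]_x (g x)%:E = mu%:E)%E.
  by rewrite /mu /mean unlock fineK// integrable_fin_num.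
have iT : (\int[P]_x (a%:E + c%:E * (g x)%:E) = (expR (t * mu))%:E)%E.
  rewrite integralD//=; last 2 first.
  - exact: finite_measure_integrable_cst.
  - exact: integrableZl.
  rewrite integralZl// Eg integral_cst//= probability_setT mule1 -EFinM -EFinD.
  by congr EFin; rewrite /a /c; ring.
rewrite -lee_fin -iT -mgfE; apply: le_integral => //.
- apply: integrableD => //; first exact: finite_measure_integrable_cst.
  exact: integrableZl.
- apply/integrableP; split.
    by apply/measurable_EFinP; apply: measurableT_comp => //; exact: measurable_funM.
  under eq_integral do rewrite /= ger0_norm ?expR_ge0//.
  by rewrite mgfE ltry.
- move=> x _; rewrite -EFinM -EFinD lee_fin.
  have -> : expR (t * g x) = expR (t * mu) * expR (t * g x - t * mu).
    by rewrite -expRD; congr expR; ring.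
  have -> : a + c * g x = expR (t * mu) * (1 + (t * g x - t * mu)).
    by rewrite /a /c; ring.
  by rewrite ler_wpM2l ?expR_ge0// expR_ge1Dx.
Qed.

End tilted_model.

(** * Indistinguishability when beta sigma tends to 0 *)

Section block_deviations.
Context {R : realType} (E : model R) (B : blocks E).

(** The ratio bound at m' = m excludes a zero variance, for which the ratio would
    be 0 / 0 = 0 < c. *)
Lemma stddev_gt0 c C n (m : Mn B n) :
  C3 B c C -> m \in Sn B n -> 0 < stddev (pcond m) (gn E n).
Proof.
move=> [c0 ratio _] mS; have /andP[le_ratio _] := ratio n m m mS mS.
rewrite sqrtr_gt0 lt_def fine_ge0 ?variance_ge0// andbT.
apply/eqP => v0; move: le_ratio.
by rewrite v0 mul0r leNgt c0.
Qed.

(** If [Sn B n] is empty then sigma n is unconstrained, and could be 0; this is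
    excluded as soon as alpha n < 1. *)
Lemma scale_gt0 alpha c C c' C' sigma n : C2 B alpha -> C3 B c C ->
  C3_scale B c' C' sigma -> alpha n < 1 -> 0 < sigma n.
Proof.
move=> [_ /(_ n) mass] hC3 [c'0 _ scale] alpha1.
have [S0|[m mS]] := set_0Vmem (Sn B n).
  move: mass; rewrite (_ : \bigcup_(_ in _) _ = set0); last first.
    by rewrite -subset0 => x [m /=]; rewrite S0 inE.
  by rewrite measure0 lee_fin; lra.
have /andP[/(lt_le_trans _) + _] := scale n m mS; apply.
by rewrite mulr_gt0// (stddev_gt0 _ _ _ _ hC3).
Qed.

End block_deviations.

Section contiguity.
Context {R : realType} (E : model R).

Lemma centered_mgfE n t :
  fine 'E_(pn E n)[fun x => expR (t * (gn E n x - mean (pn E n) (gn E n)))] =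
  expR (- (t * mean (pn E n) (gn E n))) * mgf E n t.
Proof.
rewrite unlock; set mu := mean _ _.
rewrite -[RHS]/(fine (_ * mgf E n t)%:E) EFinM -mgfE -ge0_integralZl//; last first.
  by apply/measurable_EFinP; apply: measurableT_comp => //; exact: measurable_funM.
congr fine; apply: eq_integral => x _.
by rewrite -EFinM -expRD mulrBr addrC.
Qed.

(** By [mgf_ge], the second moment M (2 b) / M (b) ^ 2 of the density is at most
    M (2 b) exp (- 2 b E g), which is the moment generating function of g - E g at 2 b. *)
Lemma chi2_density_le (K D : R) (sigma : nat -> R) n : C5 E K D sigma ->
  2 * beta E n < (D * sigma n)^-1 ->
  (\int[pn E n]_x (expR (2 * log_density E n x))%:E <=
   (expR (K * (2 * beta E n) ^+ 2 * sigma n ^+ 2 /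
      (1 - 2 * beta E n * D * sigma n)))%:E)%E.
Proof.
move=> [_ _ _ /(_ n (2 * beta E n))]; have b0 := beta_gt0 E n.
rewrite centered_mgfE ger0_norm; last by rewrite mulr_ge0// ltW.
set mu := mean _ _ => h /h {}h.
have Z2 t : 0 < mgf E n t by apply: lt_le_trans (mgf_ge E n t); exact: expR_gt0.
rewrite integral_sqr_density lee_fin.
apply: (@le_trans _ _ (expR (- (2 * beta E n * mu)) * mgf E n (2 * beta E n))).
  rewrite mulrC ler_wpM2r ?(ltW (Z2 _))//.
  rewrite expRN lef_pV2 ?posrE ?expR_gt0 ?exprn_gt0//.
  rewrite -mulrA expRM_natl lerXn2r ?nnegrE ?expR_ge0 ?(ltW (Z2 _))//.
  exact: mgf_ge.
by rewrite -ler_ln ?posrE ?expR_gt0 ?mulr_gt0 ?expR_gt0// expRK.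
Qed.

Lemma dTV_cvg0 (B : blocks E) (c C c' C' K D : R) (alpha sigma : nat -> R) :
  C2 B alpha -> C3 B c C -> C3_scale B c' C' sigma -> C5 E K D sigma ->
  beta E n * sigma n @[n --> \oo] --> (0 : R) ->
  dTV (pn E n) (qn E n) @[n --> \oo] --> 0%E.
Proof.
move=> hC2 hC3 hscale hC5 bs0; have [alpha0 _] := hC2.
have [K0 D0 _ _] := hC5.
(* Once 2 beta sigma D <= 1 / 2, the bound of C5 at 2 beta is at most
   8 K (beta sigma) ^ 2. *)
pose del n := expR (8 * K * (beta E n * sigma n) ^+ 2) - 1.
have del0 : del n @[n --> \oo] --> 0.
  rewrite [X in _ --> X](_ : _ = expR (8 * K * (0 * 0)) - 1); last first.
    by rewrite !mulr0 expR0 subrr.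
  apply: cvgB; last exact: cvg_cst.
  apply: continuous_cvg; first exact: continuous_expR.
  by apply: cvgMr; rewrite /=; apply: cvgM.
have dTVfin n : dTV (pn E n) (qn E n) = (fine (dTV (pn E n) (qn E n)))%:E.
  rewrite fineK// ge0_fin_numE ?dTV_ge0//.
  exact: le_lt_trans (dTV_le1 _ _) (ltry 1).
under eq_fun do rewrite dTVfin.
apply: cvg_EFin; first by near=> n.
apply/cvgr0Pnorm_le => e e0; near=> n.
rewrite /= ger0_norm; last exact/fine_ge0/dTV_ge0.
have del_e : del n <= e * e.
  by near: n; apply: (cvgr_le _ del0); rewrite mulr_gt0.
have sD : 4 * D * (beta E n * sigma n) <= 1.
  have : beta E n * sigma n <= (4 * D)^-1.
    by near: n; apply: (cvgr_le _ bs0); rewrite invr_gt0 mulr_gt0.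
  have D4 : 0 < 4 * D by lra.
  by rewrite -[in X in X -> _](mulr1 (4 * D)^-1) ler_pdivlMl.
have alpha1 : alpha n < 1 by near: n; apply: (cvgr_lt _ alpha0).
have s0 : 0 < sigma n by exact: scale_gt0 hC2 hC3 hscale alpha1.
rewrite -lee_fin -dTVfin.
have b0 := beta_gt0 E n.
apply: le_trans (@tilt_dTV_le _ _ _ _ _ _ (qnE E n) e (del n) e0 _) _; last first.
  by rewrite lee_fin; have : del n / e <= e by [rewrite ler_pdivrMr]; lra.
apply: le_trans (chi2_density_le _ _ _ _ hC5 _) _.
  by rewrite -div1r ltr_pdivlMr ?mulr_gt0//; lra.
rewrite lee_fin /del [leRHS]addrC subrK ler_expR.
set y := 1 - _; have y2 : 1 / 2 <= y by rewrite /y; lra.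
rewrite ler_pdivrMr; last lra.
have -> : K * (2 * beta E n) ^+ 2 * sigma n ^+ 2 =
    8 * K * (beta E n * sigma n) ^+ 2 * (1 / 2).
  by field.
by rewrite ler_wpM2l// mulr_ge0 ?sqr_ge0// mulr_ge0// ltW.
Unshelve. all: by end_near. Qed.

End contiguity.

(** * The canonical test: errors at a fixed threshold *)

Section partition.
Context {d} {T : measurableType d} {R : realType} {I : finType}.

Lemma measure_partition (P : probability T R) (S : {set I}) (A U : I -> set T) :
  trivIset [set: I] A -> (forall i, measurable (U i)) ->
  (forall i, U i `<=` A i) ->
  (P (\bigcup_(i in [set` S]) U i) = \sum_(i in S) P (U i))%E.
Proof.
move=> tA mU UA; rewrite measure_fin_bigcup//.
- rewrite -[RHS]big_enum [RHS]fsbig_seq ?enum_uniq//.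
  rewrite (_ : [set` S] = [set` enum S])//.
  by apply/seteqP; split => i /=; rewrite mem_enum.
- by move=> i j _ _ [x [Ux Ux']]; apply: tA => //; exists x; split; exact: UA.
Qed.

End partition.

Lemma mnormalizeE {d} {T : measurableType d} {R : realType}
    (mu : {measure set T -> \bar R}) (P : probability T R) U :
  (0 < mu [set: T] < +oo)%E ->
  mnormalize mu P U = (mu U * (fine (mu [set: T]))^-1%:E)%E.
Proof. by move=> /andP[mu0 muoo]; rewrite /mnormalize gt_eqF// lt_eqF. Qed.

Section test.
Context {R : realType} (E : model R) (B : blocks E) (n : nat).
Local Notation P := (pn E n).
Local Notation Q := (qn E n).
Local Notation g := (gn E n).
Local Notation b := (beta E n).

Lemma pcondE (m : Mn B n) U : C1 B ->
  (P (An m `&` U) = P (An m) * pcond m U)%E.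
Proof.
move=> hC1; have [_ _ /(_ m) Am0] := hC1 n.
have Pfin := fin_num_measure P _ (measurable_An m).
pose mu : {measure set _ -> \bar R} := mrestr P (measurable_An m).
have muT : mu [set: Omega E n] = P (An m).
  by rewrite -[RHS](congr1 P (setTI (An m))).
have -> : pcond m U = (P (U `&` An m) * (fine (P (An m)))^-1%:E)%E.
  rewrite -muT; apply: mnormalizeE.
  by rewrite muT Am0 -ge0_fin_numE.
rewrite muleCA -[X in (_ = _ * (X * _))%E](fineK Pfin) -EFinM.
by rewrite divff ?mule1 1?setIC// gt_eqF// fine_gt0// Am0 -ge0_fin_numE.
Qed.

(** C4 read on tails: passing to complements turns the distribution functions
    compared by [dKS] into upper tails. *)
Lemma pcond_tail tau (m : Mn B n) x : C4 B tau -> m \in Sn B n ->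
  ((gauss_tail x - tau n)%:E <=
   pcond m [set w | x < standardize (pcond m) g w]%R <=
   (gauss_tail x + tau n)%:E)%E.
Proof.
move=> [_ /(_ n) sup_lt] mS.
pose mu := distribution (pcond m) (standardize (pcond m) g).
have : (`|mu [set` `]-oo, x]] - @normal_prob R 0 1 [set` `]-oo, x]]|
    <= (tau n)%:E)%E.
  apply: ltW; apply: le_lt_trans sup_lt.
  apply: (@le_trans _ _ (dKS mu (normal_prob 0 1))).
    by apply: ereal_sup_ubound; exists x.
  by apply: ereal_sup_ubound; exists m.
pose U := [set w | x < standardize (pcond m) g w]; rewrite -/U.
have mU : measurable U by exact: measurable_mfun_gt.
have -> : mu [set` `]-oo, x]] = pcond m (~` U).
  by congr (pcond m _); apply/seteqP; split => w /=; rewrite in_itv/= leNgt => /negP.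
rewrite gauss_cdfE probability_setC// -(fineK (fin_num_measure (pcond m) _ mU)).
set p := fine _; rewrite -EFinB !lee_fin => /=.
by rewrite ler_norml => /andP[h1 h2]; apply/andP; split; lra.
Qed.

Definition accept (T : R) (m : Mn B n) : set (Omega E n) :=
  An m `&` [set x | standardize (pcond m) g x < T].

Lemma measurable_accept T m : measurable (accept T m).
Proof. by apply: measurableI; [exact: measurable_An|exact: measurable_mfun_lt]. Qed.

Lemma blockE (x : Omega E n) (m : Mn B n) : C1 B -> An m x -> block B x = Some m.
Proof.
move=> hC1 Amx; have [_ tA _] := hC1 n.
rewrite /block; case: pickP => [m' /= |/(_ m)]; last by rewrite mem_set.
rewrite inE => Am'x; congr Some; apply: tA => //.
by exists x.
Qed.

Lemma block_inv (x : Omega E n) (m : Mn B n) : block B x = Some m -> An m x.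
Proof. by rewrite /block; case: pickP => // m' /set_mem ? [<-]. Qed.

Lemma can_test_H0 T : C1 B ->
  [set x | can_test B T g x = H0] = \bigcup_(m in [set` Sn B n]) accept T m.
Proof.
move=> hC1; apply/seteqP; split => [x /=|x [m /= mS [Amx Yx]]].
  rewrite /can_test; case bx: (block B x) => [m|//].
  case: ifPn => //; rewrite negbK => mS; case: ifPn => // Yx _.
  by exists m => //; split; [exact: block_inv|rewrite /= ltNge].
rewrite /can_test (blockE _ _ hC1 Amx) mS /=.
by rewrite leNgt Yx.
Qed.

Lemma can_test_H1 T :
  [set x | can_test B T g x = H1] = ~` [set x | can_test B T g x = H0].
Proof. by apply/seteqP; split => x /=; case: can_test. Qed.

Lemma measurable_can_test_H0 T : C1 B -> measurable [set x | can_test B T g x = H0].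
Proof.
move=> hC1; rewrite can_test_H0//; apply: fin_bigcup_measurable => // m _.
exact: measurable_accept.
Qed.

(** The strict inequality in [accept] is handled by stepping down to T - 1, which
    avoids any continuity argument for the law of the statistic; and tau n, being
    at most half of [gauss_tail (T + 1)], is absorbed in [gauss_tail (T - 1)]. *)
Lemma accept_ge tau T (m : Mn B n) : C1 B -> C4 B tau -> m \in Sn B n ->
  2 * tau n <= gauss_tail (T + 1) ->
  (P (An m) * (1 - 2 * gauss_tail (T - 1))%:E <= P (accept T m))%E.
Proof.
move=> hC1 hC4 mS tauT; rewrite pcondE// lee_wpmul2l//.
have mU := @measurable_mfun_gt _ _ _ (standardize (pcond m) g) (T - 1).
pose U := [set w | T - 1 < standardize (pcond m) g w].
have mV := @measurable_mfun_lt _ _ _ (standardize (pcond m) g) T.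
apply: (@le_trans _ _ (pcond m (~` U))); last first.
  rewrite le_measure ?inE//; first exact: measurableC.
  by move=> w /negP; rewrite -leNgt /= => h; lra.
have /andP[_] := pcond_tail tau m (T - 1) hC4 mS.
have GT : gauss_tail (T + 1) <= gauss_tail (T - 1) by apply: gauss_tail_nincr; lra.
have G0 := gauss_tail_gt0 (T - 1).
rewrite probability_setC// -/U -(fineK (fin_num_measure (pcond m) U mU)).
set p := fine _; rewrite -EFinB !lee_fin; lra.
Qed.

Lemma type1_error_le alpha tau T : C1 B -> C2 B alpha -> C4 B tau ->
  2 * tau n <= gauss_tail (T + 1) ->
  (type1_error (can_test B T g) <= (alpha n + 2 * gauss_tail (T - 1))%:E)%E.
Proof.
move=> hC1 [_ /(_ n) mass] hC4 tauT; have [_ tA _] := hC1 n.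
rewrite /type1_error can_test_H1.
have mH0 := measurable_can_test_H0 T hC1.
rewrite probability_setC//.
set eta := 2 * gauss_tail (T - 1).
have eta0 : 0 <= eta by rewrite mulr_ge0// ltW// gauss_tail_gt0.
suff : ((1 - alpha n - eta)%:E <= P [set x | can_test B T g x = H0])%E.
  rewrite -(fineK (fin_num_measure P _ mH0)).
  by set p := fine _; rewrite -EFinB !lee_fin; lra.
rewrite can_test_H0//.
rewrite (measure_partition _ _ _ _ tA); last 2 first.
- by move=> m; exact: measurable_accept.
- by move=> m x [].
apply: (@le_trans _ _ (\sum_(m in Sn B n) P (An m) * (1 - eta)%:E)%E); last first.
  by apply: lee_sum => m mS; exact: accept_ge hC4 mS tauT.
rewrite -ge0_sume_distrl; last by move=> m _.
rewrite -(measure_partition _ _ _ _ tA); [|exact: measurable_An|by move=> m x].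
have mS : measurable (\bigcup_(m in [set` Sn B n]) An m).
  by apply: fin_bigcup_measurable => // m _; exact: measurable_An.
have : (P (\bigcup_(m in [set` Sn B n]) An m) <= 1)%E by exact: probability_le1.
move: mass; rewrite -(fineK (fin_num_measure P _ mS)) -EFinM.
set p := fine _; rewrite !lee_fin => h1 h2.
have : p * eta <= 1 * eta by rewrite ler_wpM2r.
by lra.
Qed.

(** On each block, [tilt_lower_tail] applies with a the value of the log-density
    where the statistic equals T: a unit step of the statistic raises the
    log-density by s = beta sigma_m. *)
Lemma type2_error_le c C tau T l : C1 B -> C3 B c C -> C4 B tau ->
  2 * tau n <= gauss_tail (T + 1) ->
  (forall m, m \in Sn B n -> l <= b * stddev (pcond m) g) ->
  (type2_error (can_test B T g) <= (2 * expR (- l) / gauss_tail (T + 1))%:E)%E.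
Proof.
move=> hC1 hC3 hC4 tauT lb; have [_ tA _] := hC1 n.
have G0 := gauss_tail_gt0 (T + 1); set r := _ / _.
have r0 : 0 <= r by rewrite divr_ge0 ?mulr_ge0 ?expR_ge0 ?ltW.
rewrite /type2_error can_test_H0//.
rewrite (measure_partition _ _ _ _ tA); last 2 first.
- by move=> m; exact: measurable_accept.
- by move=> m x [].
apply: (@le_trans _ _ (\sum_(m in Sn B n) r%:E * Q (An m))%E); last first.
  rewrite -ge0_sume_distrr; last by move=> m _.
  rewrite -(measure_partition _ _ _ _ tA); [|exact: measurable_An|by move=> m x].
  rewrite -[leRHS]mule1 lee_wpmul2l// probability_le1//.
  by apply: fin_bigcup_measurable => // m _; exact: measurable_An.
apply: lee_sum => m mS.
have s0 := stddev_gt0 _ _ _ _ _ _ hC3 mS.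
set s := stddev (pcond m) g in s0.
pose a := b * (mean (pcond m) g + s * T) - ln (mgf E n b).
have log_densityE x : log_density E n x =
    a + b * s * (standardize (pcond m) g x - T).
  by rewrite /log_density /a /standardize -/s; field; rewrite gt_eqF.
have bs0 : 0 < b * s by rewrite mulr_gt0// beta_gt0.
have -> : accept T m = An m `&` [set x | log_density E n x < a].
  congr (_ `&` _); apply/eq_set => x /=.
  by rewrite log_densityE gtrDl pmulr_rlt0// subr_lt0.
apply: le_trans (@tilt_lower_tail _ _ _ P Q _ (qnE E n) (An m) a (b * s)
  (gauss_tail (T + 1) / 2) _ _ _) _.
- exact: measurable_An.
- by rewrite divr_gt0.
- rewrite (_ : [set x | _ < _] =
      [set x | T + 1 < standardize (pcond m) g x]); last first.
    apply/eq_set => x /=.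
    by rewrite log_densityE ltrD2l -[X in X < _]mulr1 ltr_pM2l// ltrBrDl.
  rewrite pcondE// muleC lee_wpmul2l//.
  have /andP[+ _] := pcond_tail tau m (T + 1) hC4 mS.
  apply: le_trans; rewrite lee_fin; lra.
rewrite lee_wpmul2r// lee_fin /r invf_div mulrA (mulrC (expR _)).
by rewrite ler_wpM2r ?invr_ge0 ?(ltW G0)// ler_wpM2l// ler_expR lerN2; exact: lb.
Qed.

End test.

Section parameter_free.
Context {R : realType} (E : model R) (B : blocks E) (n : nat).

(** [pcond m] gives no mass to the complement of A_m. *)
Lemma expectation_pcond_eq (m : Mn B n) (f h : Omega E n -> R) : C1 B ->
  measurable_fun [set: Omega E n] f -> measurable_fun [set: Omega E n] h ->
  (forall x, An m x -> f x = h x) ->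
  ('E_(pcond m)[f] = 'E_(pcond m)[h])%E.
Proof.
move=> hC1 mf mh fh; rewrite unlock; apply: ae_eq_integral => //.
- exact/measurable_EFinP.
- exact/measurable_EFinP.
exists (~` An m); split.
- by apply: measurableC; exact: measurable_An.
- have := pcondE _ _ _ m (~` An m) hC1; have [_ _ /(_ m) Am0] := hC1 n.
  rewrite setICr measure0 => /esym/eqP.
  by rewrite mule_eq0 gt_eqF//= => /eqP.
- by move=> x /= + Amx; apply => _; rewrite fh.
Qed.

(** The standardized statistic only involves g - e_m, first directly and then
    through its variance under [pcond m]; on A_m this difference is free of the
    parameter. *)
Lemma can_test_gpar (c C T b : R) : C1 B -> C3 B c C -> (0 < b)%R ->
  can_test B T (gpar E n b) = can_test B T (gn E n).
Proof.
move=> hC1 [_ _ hg] b0; apply/funext => x; rewrite /can_test.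
case bx: (block B x) => [m|//]; case: ifPn => // _.
have Amx := block_inv _ _ _ _ _ bx.
have centered y : An m y -> gpar E n b y - mean (pcond m) (gpar E n b) =
    gn E n y - mean (pcond m) (gn E n).
  by move=> Amy; exact: hg b0 (beta_gt0 E n) Amy.
suff -> : standardize (pcond m) (gpar E n b) x = standardize (pcond m) (gn E n) x.
  by [].
rewrite /standardize centered//; congr (_ / Num.sqrt (fine _)).
rewrite /variance !covariance.unlock; apply: expectation_pcond_eq => //.
by move=> y Amy; congr (_ * _); exact: centered.
Qed.

End parameter_free.

(** * Distinguishability when beta sigma tends to infinity *)

Section error_bound.
Context {R : realType}.

(** A threshold 0 signals that [threshold] found no admissible value; the only
    bound available is then the trivial one. *)
Definition error_bound (C a T l : R) : R :=
  if T <= 0 then 1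
  else a + 2 * gauss_tail (T - 1) + 2 * expR (- (l / C)) / gauss_tail (T + 1).

Lemma error_bound_ge0 (C a T l : R) : 0 <= a -> 0 <= error_bound C a T l.
Proof.
move=> a0; rewrite /error_bound; case: ifP => // _.
by rewrite !addr_ge0// ?divr_ge0 ?mulr_ge0 ?expR_ge0 ?(ltW (gauss_tail_gt0 _)).
Qed.

(** From exp (2 y) >= y ^ 2 with y = l / (2 C). *)
Lemma expRN_le (C l : R) : 0 < C -> 0 < l -> l * expR (- (l / C)) <= 4 * C ^+ 2 / l.
Proof.
move=> C0 l0; set y := l / C / 2.
have y0 : 0 < y by rewrite !divr_gt0.
have ey : y ^+ 2 <= expR (l / C).
  have -> : l / C = 2 * y by rewrite /y; field; rewrite gt_eqF.
  rewrite expRM_natl lerXn2r ?nnegrE ?expR_ge0 ?(ltW y0)//.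
  by have := expR_ge1Dx y; lra.
rewrite expRN ler_pdivlMr// -mulrA mulrC -mulrA.
rewrite ler_pdivrMl ?expR_gt0//.
have -> : l * l = 4 * C ^+ 2 * y ^+ 2 by rewrite /y; field; rewrite gt_eqF.
by rewrite mulrC ler_wpM2r// mulr_ge0 ?sqr_ge0.
Qed.

(** The last term of the bound is at most 2 l exp (- l / C), since the threshold
    keeps [gauss_tail (T + 1)] at least 1 / l. *)
Lemma error_bound_cvg0 (C : R) (alpha tau L : nat -> R) : 0 < C ->
  (forall n, 0 <= alpha n) -> alpha n @[n --> \oo] --> 0 ->
  tau n @[n --> \oo] --> 0 -> L n @[n --> \oo] --> +oo ->
  error_bound C (alpha n) (threshold (L n) (tau n)) (L n) @[n --> \oo] --> 0.
Proof.
move=> C0 alpha_ge0 alpha0 tau0 Loo.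
have Too := threshold_cvgy _ _ Loo tau0.
set T := fun n => threshold (L n) (tau n) in Too *.
have T1oo : T n - 1 @[n --> \oo] --> +oo.
  apply/cvgryPge => A; near=> n; rewrite lerBrDr.
  by near: n; move/cvgryPge: Too; apply.
have Lgt0 : \forall n \near \oo, 0 < L n by move/cvgryPgt: Loo; apply.
have L0 : (L n)^-1 @[n --> \oo] --> 0 by apply/gtr0_cvgV0.
have up0 : alpha n + 2 * gauss_tail (T n - 1) + 8 * C ^+ 2 * (L n)^-1
    @[n --> \oo] --> 0.
  rewrite [X in _ --> X](_ : _ = 0 + 2 * 0 + 8 * C ^+ 2 * 0); last first.
    by rewrite !mulr0 !addr0.
  apply: cvgD; first apply: cvgD => //.
    by apply: cvgMr; exact: gauss_tail_cvg0.
  exact: cvgMr.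
apply: squeeze_cvgr up0; last exact: cvg_cst.
near=> n; rewrite error_bound_ge0//=.
have L_gt0 : 0 < L n by near: n.
have T_gt0 : 0 < T n by near: n; move/cvgryPgt: Too; apply.
rewrite -/(T n) /error_bound (lt_geF T_gt0) lerD2l.
have [T0|[_ _ LT]] := thresholdP (L n) (tau n).
  by move: T_gt0; rewrite /T T0 ltxx.
have G0 := gauss_tail_gt0 (T n + 1).
apply: (@le_trans _ _ (2 * (L n * expR (- (L n / C))))).
  rewrite -mulrA ler_wpM2l// mulrC ler_wpM2r ?expR_ge0//.
  by rewrite -[leRHS]invrK lef_pV2 ?posrE ?invr_gt0.
have := expRN_le C (L n) C0 L_gt0.
lra.
Unshelve. all: by end_near. Qed.

End error_bound.

Section distinguishing.
Context {R : realType} (E : model R) (B : blocks E) (c C c' C' : R).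
Context (alpha tau sigma L : nat -> R).
Context (hC1 : C1 B) (hC2 : C2 B alpha) (hC3 : C3 B c C).
Context (hscale : C3_scale B c' C' sigma) (hC4 : C4 B tau).
Context (Loo : L n @[n --> \oo] --> +oo).
Context (L_le : forall n, L n <= beta E n * sigma n).

Let T n := threshold (L n) (tau n).
Let Dec n := can_test B (T n) (gn E n).
Let F n := error_bound C' (alpha n) (T n) (L n).

Lemma alpha_ge0 n : 0 <= alpha n.
Proof.
have [_ /(_ n) mass] := hC2.
have mS : measurable (\bigcup_(m in [set` Sn B n]) An m).
  by apply: fin_bigcup_measurable => // m _; exact: measurable_An.
have := le_trans mass (probability_le1 _ mS); rewrite lee_fin; lra.
Qed.

Let mH0 n : measurable [set x | Dec n x = H0].
Proof. exact: measurable_can_test_H0. Qed.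

Lemma can_test_errors n :
  (type1_error (Dec n) <= (F n)%:E)%E /\ (type2_error (Dec n) <= (F n)%:E)%E.
Proof.
rewrite /F /error_bound; case: ifPn => [_|].
  split; apply: probability_le1; last exact: mH0.
  by rewrite /Dec can_test_H1; apply: measurableC; exact: mH0.
rewrite -ltNge => T0; have [T00|[_ tauT _]] := thresholdP (L n) (tau n).
  by move: T0; rewrite /T T00 ltxx.
have G1 := gauss_tail_gt0 (T n + 1); have G2 := gauss_tail_gt0 (T n - 1).
have a0 := alpha_ge0 n.
split.
  apply: le_trans (type1_error_le _ _ _ _ _ _ hC1 hC2 hC4 tauT) _.
  rewrite lee_fin lerDl ?divr_ge0 ?mulr_ge0 ?expR_ge0 ?(ltW G1)//.
have lb m : m \in Sn B n -> L n / C' <= beta E n * stddev (pcond m) (gn E n).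
  move=> mS; have [_ C'0 /(_ n m mS)/andP[_ sC]] := hscale.
  rewrite ler_pdivrMr// (le_trans (L_le n))// -mulrA (mulrC _ C').
  by rewrite ler_wpM2l// ltW// beta_gt0.
apply: le_trans (type2_error_le _ _ _ _ _ _ _ _ hC1 hC3 hC4 tauT lb) _.
by rewrite lee_fin lerDr addr_ge0// mulr_ge0// ltW.
Qed.

Lemma error_bound_F_cvg0 : F n @[n --> \oo] --> 0.
Proof.
have [_ C'0 _] := hscale; have [alpha0 _] := hC2; have [tau0 _] := hC4.
exact: error_bound_cvg0 C'0 alpha_ge0 alpha0 tau0 Loo.
Qed.

Lemma p_error_cvg0 : p_error (Dec n) @[n --> \oo] --> 0%E.
Proof.
have F0 : (F n)%:E @[n --> \oo] --> 0%E.
  by apply: cvg_EFin; [near=> n|exact: error_bound_F_cvg0].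
apply: squeeze_cvge F0; last exact: cvg_cst.
near=> n; have [e1 e2] := can_test_errors n.
by rewrite /p_error ge_max e1 e2 le_max measure_ge0.
Unshelve. all: by end_near. Qed.

(** The acceptance region of the test witnesses the lower bound 1 - 2 F n. *)
Lemma dTV_cvg1 : dTV (pn E n) (qn E n) @[n --> \oo] --> 1%E.
Proof.
have F1 : (1 - 2 * F n)%:E @[n --> \oo] --> 1%E.
  apply: cvg_EFin; first by near=> n.
  rewrite [X in _ --> X](_ : _ = 1 - 2 * 0); last by rewrite mulr0 subr0.
  by apply: cvgB; [exact: cvg_cst|apply: cvgMr; exact: error_bound_F_cvg0].
apply: squeeze_cvge F1 (cvg_cst _); near=> n; rewrite dTV_le1 andbT.
apply: le_trans (dTV_ge _ _ _ (mH0 n)).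
have [] := can_test_errors n; rewrite /type1_error /type2_error.
rewrite [X in pn E n X]can_test_H1 probability_setC//.
rewrite -(fineK (fin_num_measure (pn E n) _ (mH0 n))).
rewrite -(fineK (fin_num_measure (qn E n) _ (mH0 n))).
set p := fine _; set q := fine _.
rewrite -EFinB !lee_fin; lra.
Unshelve. all: by end_near. Qed.

End distinguishing.

Theorem theorem3p4 (R : realType) :
  [/\ forall (E : model R) (B : blocks E) (c C c' C' : R)
        (alpha tau sigma : nat -> R),
        C1 B -> C2 B alpha -> C3 B c C -> C3_scale B c' C' sigma -> C4 B tau ->
        beta E n * sigma n @[n --> \oo] --> +oo ->
        dTV (pn E n) (qn E n) @[n --> \oo] --> 1%E,
      exists Tsel : R -> R -> R, (forall l t : R, 0 <= Tsel l t) /\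
      forall c C c' C' : R, exists F : R -> R -> R -> R,
      forall (E : model R) (B : blocks E) (alpha tau sigma L : nat -> R),
        C1 B -> C2 B alpha -> C3 B c C -> C3_scale B c' C' sigma -> C4 B tau ->
        L n @[n --> \oo] --> +oo -> (forall n, L n <= beta E n * sigma n) ->
        let T n := Tsel (L n) (tau n) in
        let Dec n := can_test B (T n) (gn E n) in
        [/\ T n @[n --> \oo] --> +oo,
            forall n, (type1_error (Dec n) <= (F (alpha n) (T n) (L n))%:E)%E /\
                      (type2_error (Dec n) <= (F (alpha n) (T n) (L n))%:E)%E,
            F (alpha n) (T n) (L n) @[n --> \oo] --> (0 : R),
            p_error (Dec n) @[n --> \oo] --> 0%E
          & forall n (b : R), 0 < b ->
              can_test B (T n) (gpar E n b) = Dec n]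
    & forall (E : model R) (B : blocks E) (c C c' C' K D : R)
        (alpha sigma : nat -> R),
        C1 B -> C2 B alpha -> C3 B c C -> C3_scale B c' C' sigma ->
        C5 E K D sigma ->
        beta E n * sigma n @[n --> \oo] --> (0 : R) ->
        dTV (pn E n) (qn E n) @[n --> \oo] --> 0%E].
Proof.
split.
- move=> E B c C c' C' alpha tau sigma hC1 hC2 hC3 hscale hC4 bsoo.
  exact: dTV_cvg1 hC1 hC2 hC3 hscale hC4 bsoo (fun=> lexx _).
- exists threshold; split; first by move=> l t; exact: ler0n.
  move=> c C c' C'; exists (error_bound C').
  move=> E B alpha tau sigma L hC1 hC2 hC3 hscale hC4 Loo L_le T Dec.
  have [tau0 _] := hC4; split.
  + exact: threshold_cvgy.
  + exact: can_test_errors hC1 hC2 hC3 hscale hC4 L_le.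
  + exact: error_bound_F_cvg0 hC2 hscale hC4 Loo.
  + exact: p_error_cvg0 hC1 hC2 hC3 hscale hC4 Loo L_le.
  + by move=> n b b0; exact: can_test_gpar hC1 hC3 b0.
- move=> E B c C c' C' K D alpha sigma _ hC2 hC3 hscale hC5 bs0.
  exact: dTV_cvg0 hC2 hC3 hscale hC5 bs0.
Qed.
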